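(* Let $R$ be a separative exchange ring. Then $R$ is a $GE$-ring, and consequently the natural homomorphism $GL_1(R)\rightarrow K_1(R)$ (from the group of units of $R$ to the algebraic Whitehead group $K_1(R)$) is surjective.
   Context: All rings are unital and modules are right modules. A ring $R$ is an exchange ring if the right module $R_R$ has the finite exchange property: for every module $A$ and internal direct sum decompositions $A=M'\oplus N=A_1\oplus\cdots\oplus A_n$ with $M'\cong R_R$, there exist submodules $A_i'\subseteq A_i$ with $A=M'\oplus A_1'\oplus\cdots\oplus A_n'$ (equivalently: for every $a\in R$ there is an idempotent $e\in aR$ with $1-e\in(1-a)R$). $R$ is separative if for all finitely generated projective right $R$-modules $A,B$: $A\oplus A\cong A\oplus B\cong B\oplus B$ implies $A\cong B$. An elementary matrix is a transvection $I+re_{ij}$ with $i\neq j$, $r\in R$, $e_{ij}$ a matrix unit. $E_n(R)$ is the subgroup of $GL_n(R)$ generated by elementary matrices and $D_n(R)$ the subgroup of invertible diagonal matrices. $R$ is a $GE_n$-ring if $GL_n(R)$ is generated by $E_n(R)$ and $D_n(R)$, and a $GE$-ring if it is a $GE_n$-ring for all $n\ge 1$. *)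

(* Defs.v *)
From HB Require Import structures.
From mathcomp Require Import all_boot all_order all_algebra.
Set Implicit Arguments. Unset Strict Implicit. Unset Printing Implicit Defensive.
Import GRing.Theory.
Local Open Scope ring_scope.

Section Defs.
Variable R : nzRingType.

Definition is_unit (u : R) : Prop := exists v : R, u * v = 1 /\ v * u = 1.

(* Exchange ring, via the elementwise characterization given in the context:
   for every a there is an idempotent e in aR with 1 - e in (1 - a)R. *)
Definition exchange_ring : Prop :=
  forall a : R, exists e : R,
    e * e = e /\ (exists r : R, e = a * r) /\ (exists s : R, 1 - e = (1 - a) * s).

(* Finitely generated projective right R-modules are (up to isomorphism)
   the modules e R^n (column vectors) for idempotent e in M_n(R).
   A right-R-linear map e R^n -> f R^m is left multiplication by a matrix
   x with x = f x e; such modules are isomorphic iff there are x, y with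
   y x = e and x y = f.  Direct sum e R^n (+) f R^m = diag(e,f) R^(n+m). *)
Definition idem_mx n (e : 'M[R]_n) : Prop := e *m e = e.

Definition fgp_iso n m (e : 'M[R]_n) (f : 'M[R]_m) : Prop :=
  exists (x : 'M[R]_(m, n)) (y : 'M[R]_(n, m)),
    x = f *m x *m e /\ y = e *m y *m f /\ y *m x = e /\ x *m y = f.

Definition fgp_sum n m (e : 'M[R]_n) (f : 'M[R]_m) : 'M[R]_(n + m) :=
  block_mx e 0 0 f.

Definition separative : Prop :=
  forall n m (e : 'M[R]_n) (f : 'M[R]_m), idem_mx e -> idem_mx f ->
    fgp_iso (fgp_sum e e) (fgp_sum e f) ->
    fgp_iso (fgp_sum e f) (fgp_sum f f) -> fgp_iso e f.

Definition invertible_mx n (A : 'M[R]_n) : Prop :=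
  exists B : 'M[R]_n, A *m B = 1%:M /\ B *m A = 1%:M.

Definition elementary_mx n (A : 'M[R]_n) : Prop :=
  exists (i j : 'I_n) (r : R), i != j /\ A = 1%:M + r *: delta_mx i j.

Definition inv_diag_mx n (A : 'M[R]_n) : Prop :=
  exists d : 'rV[R]_n, (forall i, is_unit (d 0 i)) /\ A = diag_mx d.

Inductive gen_group n (S : 'M[R]_n -> Prop) : 'M[R]_n -> Prop :=
  | gen_one : gen_group S 1%:M
  | gen_in A : S A -> gen_group S A
  | gen_mul A B : gen_group S A -> gen_group S B -> gen_group S (A *m B)
  | gen_inv A B : gen_group S A -> A *m B = 1%:M -> B *m A = 1%:M -> gen_group S B.

Definition E_mx n (A : 'M[R]_n) : Prop := gen_group (@elementary_mx n) A.

Definition GE_n (n : nat) : Prop :=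
  forall A : 'M[R]_n, invertible_mx A ->
    gen_group (fun M => elementary_mx M \/ inv_diag_mx M) A.

Definition GE_ring : Prop := forall n : nat, (1 <= n)%N -> GE_n n.

(* stabilization GL_n -> GL_p (n <= p): A |-> diag(A, I_(p-n)) *)
Definition stab_mx n p (A : 'M[R]_n) : 'M[R]_p :=
  \matrix_(i < p, j < p)
    match (insub (val i) : option 'I_n), (insub (val j) : option 'I_n) with
    | Some i', Some j' => A i' j'
    | _, _ => ((val i == val j)%:R : R)
    end.

(* A in GL_n and B in GL_m have the same class in K_1(R) = GL(R)/E(R) *)
Definition K1_eq n m (A : 'M[R]_n) (B : 'M[R]_m) : Prop :=
  exists p, (n <= p)%N /\ (m <= p)%N /\
    exists M : 'M[R]_p, E_mx M /\ stab_mx p A = M *m stab_mx p B.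

Definition GL1_K1_surjective : Prop :=
  forall n (A : 'M[R]_n), invertible_mx A ->
    exists u : R, is_unit u /\ K1_eq A (u%:M : 'M[R]_1).
End Defs.

(* Main.v *)
(** Let A be invertible of size 1 + m, viewed as an isomorphism P1 + P2 -> Q1 + Q2 with
    P1 = Q1 = R and P2 = Q2 = R^m. The exchange property applied to the first row brings
    A, by elementary operations, to a form in which Q1 = E + F, Q2 = G + H,
    P1 = E + G, P2 = F + H and A is the identity on each of the four summands.
    If E and H have isomorphic summands X, then a product of three transvections moves
    both copies of X away, replacing F by F + X and G by G + X; conversely, isomorphic
    summands of F and G can be moved to E and H.
    Since E embeds in R^m = F + H, exchange splits E into a summand that embeds in F and
    a summand that embeds in H; moving the latter away makes E embed in F. As E also
    embeds in Q2 = G + H, the same step makes E embed in G as well. Now E + F = R = E + G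
    with E embedded in both F and G, so separativity gives F = G up to isomorphism.
    Moving all of F and G into E and H makes A block diagonal, and one concludes by
    induction on m and Whitehead's lemma. *)
Require Import Defs.
From mathcomp Require Import all_boot all_order all_algebra.
Set Implicit Arguments. Unset Strict Implicit. Unset Printing Implicit Defensive.
Import GRing.Theory.
Local Open Scope ring_scope.

(** * Isomorphism, embedding and cancellation of finitely generated projective modules *)

Section Iso.
Variable R : nzRingType.

Lemma idem_compl n (e : 'M[R]_n) : idem_mx e -> idem_mx (1%:M - e).
Proof. by move=> ee; rewrite /idem_mx mulmxBr mulmx1 mulmxBl mul1mx ee subrr subr0. Qed.

(** Untruncated maps suffice: [f *m x] and [x *m e] are both [x *m y *m x], so cutting [x] and [y]
    down by the idempotents keeps them mutually inverse. *)
Lemma fgp_iso_intro n m (e : 'M[R]_n) (f : 'M[R]_m) (x : 'M_(m, n)) (y : 'M_(n, m)) :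
  idem_mx e -> idem_mx f -> y *m x = e -> x *m y = f -> fgp_iso e f.
Proof.
move=> ee ff yx xy; exists (f *m x *m e), (e *m y *m f).
have fx : f *m x = x *m e by rewrite -xy -yx mulmxA.
have ey : e *m y = y *m f by rewrite -xy -yx mulmxA.
split; first by rewrite !mulmxA ff -!mulmxA ee.
split; first by rewrite !mulmxA ee -!mulmxA ff.
split.
  by rewrite fx -[x *m e *m e]mulmxA ee !mulmxA -[e *m y *m f *m x]mulmxA fx
    !mulmxA -[_ *m y *m x]mulmxA yx !ee.
by rewrite ey -[y *m f *m f]mulmxA ff !mulmxA -[f *m x *m e *m y]mulmxA ey
    !mulmxA -[_ *m x *m y]mulmxA xy !ff.
Qed.

Lemma fgp_iso_sym n m (e : 'M[R]_n) (f : 'M[R]_m) : fgp_iso e f -> fgp_iso f e.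
Proof. by move=> [x [y [? [? [? ?]]]]]; exists y, x. Qed.

Lemma fgp_iso_refl n (e : 'M[R]_n) : idem_mx e -> fgp_iso e e.
Proof. by move=> ee; apply: (fgp_iso_intro (x := e) (y := e)). Qed.

Lemma fgp_iso_trans n m k (e : 'M[R]_n) (f : 'M[R]_m) (g : 'M[R]_k) :
  idem_mx e -> idem_mx g -> fgp_iso e f -> fgp_iso f g -> fgp_iso e g.
Proof.
move=> ee gg [x [y [xE [yE [yx xy]]]]] [z [t [zE [tE [tz zt]]]]].
apply: (fgp_iso_intro (x := z *m x) (y := y *m t)) => //.
  by rewrite mulmxA -[y *m t *m z]mulmxA tz yE -!mulmxA [f *m (f *m x)]mulmxA
     -{2}xy !mulmxA -[_ *m y *m x]mulmxA yx -[_ *m f *m x]mulmxA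
     -{1}xy !mulmxA -[_ *m y *m x]mulmxA yx -[_ *m y *m x]mulmxA yx !ee.
rewrite mulmxA -[z *m x *m y]mulmxA xy -tz !mulmxA zt -[g *m z *m t]mulmxA zt.
exact: gg.
Qed.

Lemma idem_sum n m (e : 'M[R]_n) (f : 'M[R]_m) :
  idem_mx e -> idem_mx f -> idem_mx (fgp_sum e f).
Proof.
by move=> ee ff; rewrite /idem_mx /fgp_sum mulmx_block !mulmx0 !mul0mx !addr0 !add0r ee ff.
Qed.

Lemma fgp_sum_iso n m n' m' (e : 'M[R]_n) (f : 'M[R]_m) (e' : 'M[R]_n') (f' : 'M[R]_m') :
  idem_mx e -> idem_mx f -> idem_mx e' -> idem_mx f' ->
  fgp_iso e e' -> fgp_iso f f' -> fgp_iso (fgp_sum e f) (fgp_sum e' f').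
Proof.
move=> ee ff ee' ff' [x [y [_ [_ [yx xy]]]]] [z [t [_ [_ [tz zt]]]]].
apply: (fgp_iso_intro (x := block_mx x 0 0 z) (y := block_mx y 0 0 t));
  try exact: idem_sum;
by rewrite /fgp_sum mulmx_block !mulmx0 !mul0mx !addr0 !add0r ?yx ?xy ?tz ?zt.
Qed.

Lemma fgp_sumC n m (e : 'M[R]_n) (f : 'M[R]_m) :
  idem_mx e -> idem_mx f -> fgp_iso (fgp_sum e f) (fgp_sum f e).
Proof.
move=> ee ff.
apply: (fgp_iso_intro (x := block_mx 0 f e 0) (y := block_mx 0 e f 0));
  try exact: idem_sum;
by rewrite /fgp_sum mulmx_block !mulmx0 !mul0mx !addr0 !add0r ?ee ?ff.
Qed.

Lemma fgp_sumA n m k (e : 'M[R]_n) (f : 'M[R]_m) (g : 'M[R]_k) :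
  idem_mx e -> idem_mx f -> idem_mx g ->
  fgp_iso (fgp_sum e (fgp_sum f g)) (fgp_sum (fgp_sum e f) g).
Proof.
move=> ee ff gg.
apply: (fgp_iso_intro
  (x := block_mx (col_mx e 0) (block_mx 0 0 f 0) 0 (row_mx 0 g))
  (y := block_mx (row_mx e 0) 0 (block_mx 0 f 0 0) (col_mx 0 g)));
  try by do ?apply: idem_sum.
- rewrite /fgp_sum mulmx_block !mulmx0 !mul0mx !addr0.
  rewrite !(mul_row_col, mul_col_row, mul_row_block, mul_block_col, mulmx_block).
  rewrite ?(mulmx0, mul0mx, addr0, add0r) ?(mul_mx_row, mul_col_mx) ?(mulmx0, mul0mx).
  by rewrite ?(row_mx0, col_mx0) ?block_mxEv ?(row_mx0, col_mx0) ?add_col_mx ?add_row_mx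
    ?(addr0, add0r) ee ff gg.
- rewrite /fgp_sum mulmx_block !mulmx0 !mul0mx !add0r.
  rewrite !(mul_row_col, mul_col_row, mul_row_block, mul_block_col, mulmx_block).
  rewrite ?(mulmx0, mul0mx, addr0, add0r) ?(mul_mx_row, mul_col_mx) ?(mulmx0, mul0mx).
  by rewrite ?(row_mx0, col_mx0) ?block_mxEv ?(row_mx0, col_mx0) ?add_col_mx ?add_row_mx
    ?(addr0, add0r) ee ff gg.
Qed.

(** For idempotents, the module of [c] is isomorphic to a direct summand of that of [a], with
    embedding [i] and retraction [p]. *)
Definition fgp_le k n (c : 'M[R]_k) (a : 'M[R]_n) :=
  exists (i : 'M[R]_(n, k)) (p : 'M[R]_(k, n)), a *m i = i /\ p *m a = p /\ p *m i = c.

Lemma fgp_le_compl k n (c : 'M[R]_k) (a : 'M[R]_n) :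
  idem_mx c -> idem_mx a -> fgp_le c a ->
  exists2 d : 'M[R]_n, idem_mx d & fgp_iso a (fgp_sum c d).
Proof.
move=> cc aa [i0 [p0 [ai0 [p0a p0i0]]]].
(* Truncation by [c] adds [i *m c = i] and [c *m p = p]; then [a - i *m p] is the idempotent of the
   complement. *)
pose i := i0 *m c; pose p := c *m p0.
have ai : a *m i = i by rewrite mulmxA ai0.
have pa : p *m a = p by rewrite -mulmxA p0a.
have pi : p *m i = c by rewrite /p /i mulmxA -[c *m p0 *m i0]mulmxA p0i0 cc.
have ic : i *m c = i by rewrite -mulmxA cc.
have cp : c *m p = p by rewrite mulmxA cc.
clearbody i p.
have dd : idem_mx (a - i *m p).
  rewrite /idem_mx mulmxBl !mulmxBr aa !mulmxA ai -[i *m p *m a]mulmxA pa.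
  by rewrite -[i *m p *m i]mulmxA pi ic subrr subr0.
have pd : p *m (a - i *m p) = 0 by rewrite mulmxBr pa mulmxA pi cp subrr.
have di : (a - i *m p) *m i = 0 by rewrite mulmxBl ai -mulmxA pi ic subrr.
exists (a - i *m p) => //.
apply: (fgp_iso_intro (x := col_mx p (a - i *m p)) (y := row_mx i (a - i *m p))) => //.
- exact: idem_sum.
- by rewrite mul_row_col dd addrC subrK.
- by rewrite mul_col_row pi pd di dd.
Qed.

(* With a = c + a' and b = c + b', adding a' or b' to both sides of a + c = b + c gives
   a + a = a + b and a + b = b + b, so no refinement is needed. *)
Lemma separative_cancel k n m (c : 'M[R]_k) (a : 'M[R]_n) (b : 'M[R]_m) :
  separative R -> idem_mx c -> idem_mx a -> idem_mx b ->
  fgp_le c a -> fgp_le c b ->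
  fgp_iso (fgp_sum a c) (fgp_sum b c) -> fgp_iso a b.
Proof.
move=> sepR cc aa bb /(fgp_le_compl cc aa)[a' aa' ia] /(fgp_le_compl cc bb)[b' bb' ib] iab.
have step l (d d' : 'M[R]_l) : idem_mx d -> idem_mx d' -> fgp_iso d (fgp_sum c d') ->
    fgp_iso (fgp_sum a d) (fgp_sum b d).
  move=> dd dd' id.
  have cd := idem_sum cc dd'.
  have I1 : fgp_iso (fgp_sum a d) (fgp_sum (fgp_sum a c) d').
    apply: (@fgp_iso_trans _ _ _ _ (fgp_sum a (fgp_sum c d'))); do ?exact: idem_sum.
    - by apply: idem_sum => //; apply: idem_sum.
    - by apply: fgp_sum_iso => //; apply: fgp_iso_refl.
    - exact: fgp_sumA.
  have I2 : fgp_iso (fgp_sum b d) (fgp_sum (fgp_sum b c) d').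
    apply: (@fgp_iso_trans _ _ _ _ (fgp_sum b (fgp_sum c d'))); do ?exact: idem_sum.
    - by apply: idem_sum => //; apply: idem_sum.
    - by apply: fgp_sum_iso => //; apply: fgp_iso_refl.
    - exact: fgp_sumA.
  have ac := idem_sum aa cc; have bc := idem_sum bb cc.
  apply: (fgp_iso_trans _ _ I1); do ?exact: idem_sum.
  apply: (@fgp_iso_trans _ _ _ _ (fgp_sum (fgp_sum b c) d')); do ?exact: idem_sum.
    by apply: fgp_sum_iso => //; apply: fgp_iso_refl.
  exact: fgp_iso_sym.
apply: sepR => //; last exact: (step _ b b').
apply: (@fgp_iso_trans _ _ _ _ (fgp_sum b a)); do ?exact: idem_sum.
  exact: (step _ a a').
exact: fgp_sumC.
Qed.

End Iso.

(** * Block transvections and swaps as products of elementary matrices *)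

Section Elementary.
Variable R : nzRingType.

(** Sums of blocks become products of matrices, so one nonzero entry at a time is enough, and that
    is a transvection. *)
Lemma E_upper n m (x : 'M[R]_(n, m)) : E_mx (block_mx 1%:M x 0 1%:M).
Proof.
pose P (z : 'M[R]_(n, m)) := E_mx (block_mx 1%:M z 0 1%:M).
rewrite -/(P x) (matrix_sum_delta x).
have P0 : P 0 by rewrite /P -scalar_mx_block; apply: gen_one.
have PD y z : P y -> P z -> P (y + z).
  rewrite /P => Py Pz; have := gen_mul Pz Py.
  by rewrite mulmx_block !(mul1mx, mulmx1, mul0mx, mulmx0, addr0, add0r).
apply: (big_ind P) => // i _; apply: (big_ind P) => // j _.
apply: gen_in; exists (lshift m i), (rshift n j), (x i j).
split; first by rewrite eq_lrshift.
rewrite (scalar_mx_block n m); apply/matrixP => u v.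
case: (split_ordP u) => u' ->; case: (split_ordP v) => v' ->;
by rewrite [RHS]mxE ?(block_mxEul, block_mxEur, block_mxEdl, block_mxEdr) !mxE
  ?(eq_lshift, eq_rshift, eq_lrshift, eq_rlshift) ?andbF ?mulr0 ?addr0 ?add0r.
Qed.

Lemma E_lower n m (x : 'M[R]_(m, n)) : E_mx (block_mx 1%:M 0 x 1%:M).
Proof.
pose P (z : 'M[R]_(m, n)) := E_mx (block_mx 1%:M 0 z 1%:M).
rewrite -/(P x) (matrix_sum_delta x).
have P0 : P 0 by rewrite /P -scalar_mx_block; apply: gen_one.
have PD y z : P y -> P z -> P (y + z).
  rewrite /P => Py Pz; have := gen_mul Py Pz.
  by rewrite mulmx_block !(mul1mx, mulmx1, mul0mx, mulmx0, addr0, add0r).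
apply: (big_ind P) => // i _; apply: (big_ind P) => // j _.
apply: gen_in; exists (rshift n i), (lshift m j), (x i j).
split; first by rewrite eq_rlshift.
rewrite (scalar_mx_block n m); apply/matrixP => u v.
case: (split_ordP u) => u' ->; case: (split_ordP v) => v' ->;
by rewrite [RHS]mxE ?(block_mxEul, block_mxEur, block_mxEdl, block_mxEdr) !mxE
  ?(eq_lshift, eq_rshift, eq_lrshift, eq_rlshift) ?andbF ?mulr0 ?addr0 ?add0r.
Qed.

Lemma E_block1 n m (M : 'M[R]_m) : E_mx M -> E_mx (block_mx (1%:M : 'M_n) 0 0 M).
Proof.
elim=> [|A [i [j [r [ij ->]]]]|A B _ IA _ IB|A B _ IA AB BA].
- by rewrite -scalar_mx_block; apply: gen_one.
- apply: gen_in; exists (rshift n i), (rshift n j), r; split; first by rewrite eq_rshift.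
  rewrite (scalar_mx_block n m); apply/matrixP => u v.
  case: (split_ordP u) => u' ->; case: (split_ordP v) => v' ->;
  by rewrite [RHS]mxE ?(block_mxEul, block_mxEur, block_mxEdl, block_mxEdr) !mxE
    ?(eq_lshift, eq_rshift, eq_lrshift, eq_rlshift) ?andbF ?mulr0 ?addr0 ?add0r.
- have := gen_mul IA IB.
  by rewrite mulmx_block !(mul1mx, mulmx1, mul0mx, mulmx0, addr0, add0r).
- by apply: (gen_inv IA); rewrite mulmx_block ?AB ?BA
    !(mul1mx, mulmx1, mul0mx, mulmx0, addr0, add0r) -scalar_mx_block.
Qed.

(** Conjugation by an invertible diagonal matrix only rescales the coefficient of a transvection. *)
Lemma E_conj_diag n (d d' : 'rV[R]_n) (M : 'M[R]_n) :
  diag_mx d *m diag_mx d' = 1%:M -> diag_mx d' *m diag_mx d = 1%:M ->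
  E_mx M -> E_mx (diag_mx d *m M *m diag_mx d').
Proof.
move=> dd' d'd; elim=> [|A [i [j [r [ij ->]]]]|A B _ IA _ IB|A B _ IA AB BA].
- by rewrite mulmx1 dd'; apply: gen_one.
- apply: gen_in; exists i, j, (d 0 i * r * d' 0 j); split => //.
  rewrite mulmxDr mulmxDl mulmx1 dd'; congr (_ + _).
  apply/matrixP => u v; rewrite mul_diag_mx mul_mx_diag !mxE.
  by case: eqP => [->|_]; case: eqP => [->|_];
     rewrite /= ?(mulr0, mulr1, mul0r, mulrA).
- have -> : diag_mx d *m (A *m B) *m diag_mx d' =
    (diag_mx d *m A *m diag_mx d') *m (diag_mx d *m B *m diag_mx d').
    by rewrite !mulmxA -[_ *m diag_mx d' *m diag_mx d]mulmxA d'd mulmx1.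
  exact: gen_mul.
- by apply: (gen_inv IA);
    rewrite !mulmxA -[_ *m diag_mx d' *m diag_mx d]mulmxA d'd mulmx1
      -[diag_mx d *m _ *m _]mulmxA ?AB ?BA mulmx1 dd'.
Qed.


Lemma E_inv n (A : 'M[R]_n) : E_mx A -> exists B, [/\ E_mx B, A *m B = 1%:M & B *m A = 1%:M].
Proof.
elim=> [|{}A [i [j [r [ij ->]]]]|B C _ [B' [EB BB' B'B]] _ [C' [EC CC' C'C]]|B C EB [B' _] BC CB].
- by exists 1%:M; rewrite mulmx1; split=> //; apply: gen_one.
- exists (1%:M + (- r) *: delta_mx i j).
  have N s t : (s *: delta_mx i j : 'M[R]_n) *m (t *: delta_mx i j) = 0.
    apply/matrixP=> u v; rewrite !mxE big1 // => k _; rewrite !mxE.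
    have [->|] := eqVneq k j; last by rewrite andbF mulr0 mul0r.
    by rewrite [j == i]eq_sym (negPf ij) /= !mulr0.
  split; first by apply: gen_in; exists i, j, (- r).
  + by rewrite mulmxDl mul1mx mulmxDr mulmx1 N addr0 scaleNr addrNK.
  + by rewrite mulmxDl mul1mx mulmxDr mulmx1 N addr0 scaleNr addrK.
- exists (C' *m B'); split; first exact: gen_mul.
  + by rewrite mulmxA -[B *m C *m C']mulmxA CC' mulmx1.
  + by rewrite mulmxA -[C' *m B' *m B]mulmxA B'B mulmx1.
- by exists B; split.
Qed.

(* The product of the transvections with blocks [x], [- y] and [x]; it exchanges the
   isomorphic summands given by [y *m x] and [x *m y]. *)
Lemma E_swap n m (x : 'M[R]_(m, n)) (y : 'M[R]_(n, m)) : x *m y *m x = x ->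
  E_mx (block_mx (1%:M - y *m x) (- y) x (1%:M - x *m y)).
Proof.
move=> xyx; have := gen_mul (gen_mul (E_lower x) (E_upper (- y))) (E_lower x).
rewrite !mulmx_block !(mul1mx, mulmx1, mul0mx, mulmx0, addr0, add0r).
by rewrite !(mulNmx, mulmxN) mulmxDl mul1mx !mulNmx xyx [- x + x]addrC subrr addr0 [- _ + 1%:M]addrC.
Qed.

(** The inverse of a swap is the swap for [- x] and [- y], which has the same diagonal blocks. *)
Lemma mul_swap n m (x : 'M[R]_(m, n)) (y : 'M[R]_(n, m)) :
    x *m y *m x = x -> y *m x *m y = y ->
  block_mx (1%:M - y *m x) (- y) x (1%:M - x *m y) *m
  block_mx (1%:M - y *m x) y (- x) (1%:M - x *m y) = 1%:M.
Proof.
move=> xyx yxy.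
rewrite mulmx_block (scalar_mx_block n m); congr block_mx;
  rewrite !(mulmxBr, mulmxBl, mulmxN, mulNmx, mulmx1, mul1mx, opprK, mulmxA) ?xyx ?yxy.
- by rewrite subrr subr0 subrK.
- by rewrite subrr add0r addNr.
- by rewrite subrr add0r addNr.
- by rewrite subrr subr0 addrC subrK.
Qed.

End Elementary.

(** * Splittings of an invertible matrix and the moving of summands *)

Section Splitting.
Variable R : nzRingType.

Lemma exchange_mx11 : exchange_ring R -> forall a : 'M[R]_1, exists e : 'M[R]_1,
  [/\ idem_mx e, exists r, e = a *m r & exists s, 1%:M - e = (1%:M - a) *m s].
Proof.
move=> exR a; have [e [ee [[r er] [s es]]]] := exR (a 0 0).
exists e%:M; split.
- by rewrite /idem_mx -scalar_mxM ee.
- by exists r%:M; rewrite [a]mx11_scalar er scalar_mxM.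
- by exists s%:M; rewrite {1}[a]mx11_scalar -!raddfB /= es scalar_mxM.
Qed.

(** An exchange idempotent [e] for [x] is a right multiple of [x], hence [g *m e = e], and
    [f = e *m g] works: multiplying [1 - e] by [g] on both sides gives [g - f]. *)
Lemma exchange_corner : exchange_ring R -> forall g x : 'M[R]_1, idem_mx g -> g *m x = x ->
  exists f : 'M[R]_1, [/\ idem_mx f, g *m f = f, f *m g = f,
    exists r, f = x *m r & exists s, g - f = (g - x) *m s].
Proof.
move=> exR g x gg gx; have [e [ee [r er] [s es]]] := exchange_mx11 exR x.
have ge : g *m e = e by rewrite er mulmxA gx.
exists (e *m g); split.
- by rewrite /idem_mx mulmxA -[e *m g *m e]mulmxA ge ee.
- by rewrite mulmxA ge.
- by rewrite -mulmxA gg.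
- by exists (r *m g); rewrite er mulmxA.
exists (s *m g).
have -> : g - x = g *m (1%:M - x) by rewrite mulmxBr mulmx1 gx.
by rewrite mulmxA -[g *m _ *m s]mulmxA -es mulmxBr mulmx1 ge mulmxBl gg.
Qed.

Variable m : nat.
Implicit Types (A : 'M[R]_(1 + m)) (g : 'M[R]_1) (h : 'M[R]_m).

(** The projection onto Q1 along Q2. Conjugated by [B], it projects P1 + P2 onto the preimage of Q1;
    block diagonality then says that the preimages of Q1 and Q2 both split along P1 + P2. *)
Definition corner1 : 'M[R]_(1 + m) := block_mx 1%:M 0 0 0.

(* In the notation of the header, [g], [1 - g], [h], [1 - h] are the idempotents of
   E, G, F, H respectively. *)
Definition splits_as A g h := exists B C : 'M[R]_(1 + m),
  [/\ exists L N, [/\ E_mx L, E_mx N & B = L *m A *m N], B *m C = 1%:M, C *m B = 1%:M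
    & C *m corner1 *m B = block_mx g 0 0 h].

Lemma splits_as_conj A g h g' h' (w w' : 'M[R]_(1 + m)) :
  splits_as A g h -> E_mx w -> w *m w' = 1%:M -> w' *m w = 1%:M ->
  w' *m block_mx g 0 0 h *m w = block_mx g' 0 0 h' -> splits_as A g' h'.
Proof.
move=> [B [C [[L [N [EL EN ->]]] BC CB CpB]]] Ew ww' w'w Ew'; rewrite -CpB in Ew'.
exists (L *m A *m N *m w), (w' *m C); split.
- by exists L, (N *m w); split=> //; [apply: gen_mul | rewrite mulmxA].
- by rewrite mulmxA -[_ *m w *m w']mulmxA ww' mulmx1.
- by rewrite mulmxA -[w' *m C *m _]mulmxA CB mulmx1.
- by rewrite -Ew' !mulmxA.
Qed.

Lemma splits_as_idem A g h : splits_as A g h -> idem_mx g /\ idem_mx h.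
Proof.
move=> [B [C [_ BC _ CpB]]].
have : idem_mx (block_mx g 0 0 h).
  rewrite -CpB /idem_mx !mulmxA -[_ *m B *m C]mulmxA BC mulmx1 -[C *m _ *m _]mulmxA.
  by rewrite /corner1 mulmx_block !(mulmx0, mul0mx, mulmx1, addr0).
by rewrite /idem_mx mulmx_block !(mulmx0, mul0mx, addr0, add0r) => /eq_block_mx[].
Qed.

(** [C] maps Q1 isomorphically onto its preimage under [B], which is E + F. *)
Lemma splits_as_iso A g h : splits_as A g h -> fgp_iso (1%:M : 'M[R]_1) (fgp_sum g h).
Proof.
move=> sA; have [gg hh] := splits_as_idem sA.
have [B [C [_ BC _ CpB]]] := sA.
apply: (fgp_iso_intro (x := C *m col_mx 1%:M 0) (y := row_mx 1%:M 0 *m B)).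
- by rewrite /idem_mx mulmx1.
- exact: idem_sum.
- by rewrite mulmxA -[_ *m B *m C]mulmxA BC mulmx1 mul_row_col mulmx1 mulmx0 addr0.
- rewrite mulmxA -[_ *m _ *m row_mx _ _]mulmxA mul_col_row -/(fgp_sum g h) /fgp_sum -CpB.
  by rewrite !(mulmx0, mul0mx, mulmx1).
Qed.

(** The equations place [y *m x] inside E and its copy [x *m y] inside H. Conjugating by the swap
    hands the first to G and the second to F. *)
Lemma splits_as_swap A g h (x : 'M[R]_(m, 1)) (y : 'M[R]_(1, m)) :
  splits_as A g h -> x *m y *m x = x -> y *m x *m y = y ->
  g *m y = y -> x *m g = x -> h *m x = 0 -> y *m h = 0 ->
  splits_as A (g - y *m x) (h + x *m y).
Proof.
move=> sA xyx yxy gy xg hx yh.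
apply: (splits_as_conj sA (E_swap xyx) (mul_swap xyx yxy)).
  have := @mul_swap _ _ _ (- x) (- y); rewrite !(mulNmx, mulmxN, opprK) xyx yxy; exact.
rewrite !mulmx_block !(mulmx0, mul0mx, addr0, add0r).
congr block_mx; rewrite !(mulmxBl, mulmxBr, mulNmx, mulmxN, mulmxA, mul1mx, mulmx1).
- rewrite yh mul0mx addr0 -[y *m x *m g]mulmxA xg gy.
  by rewrite yxy subrr subr0.
- by rewrite yh !(mul0mx) subrr addr0 gy -[y *m x *m g]mulmxA xg yxy subrr oppr0.
- by rewrite hx -[x *m y *m h]mulmxA yh mulmx0 mul0mx subrr addr0 xg xyx ?opprB ?(addNr, subrr).
- by rewrite opprK xg hx -[x *m y *m h]mulmxA yh mulmx0 !(mul0mx, subr0) addrC.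
Qed.

(** The reverse move: [y *m x] lies in G and goes to E, [x *m y] lies in F and goes to H. *)
Lemma splits_as_swapV A g h (x : 'M[R]_(m, 1)) (y : 'M[R]_(1, m)) :
  splits_as A g h -> x *m y *m x = x -> y *m x *m y = y ->
  g *m y = 0 -> x *m g = 0 -> h *m x = x -> y *m h = y ->
  splits_as A (g + y *m x) (h - x *m y).
Proof.
move=> sA xyx yxy gy xg hx yh.
apply: (splits_as_conj sA (E_swap xyx) (mul_swap xyx yxy)).
  have := @mul_swap _ _ _ (- x) (- y); rewrite !(mulNmx, mulmxN, opprK) xyx yxy; exact.
rewrite !mulmx_block !(mulmx0, mul0mx, addr0, add0r).
congr block_mx; rewrite !(mulmxBl, mulmxBr, mulNmx, mulmxN, mulmxA, mul1mx, mulmx1).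
- by rewrite yh -[y *m x *m g]mulmxA xg mulmx0 gy !(mul0mx, subr0).
- by rewrite yh -[y *m x *m g]mulmxA xg mulmx0 gy yxy subrr !(subr0, oppr0, mul0mx) addr0.
- by rewrite hx -[x *m y *m h]mulmxA yh xg xyx ?mul0mx ?oppr0 ?(addNr, subrr) ?(mul0mx, subr0, oppr0) ?addr0 ?subrr.
- rewrite opprK xg hx mul0mx add0r -[x *m y *m h]mulmxA yh.
  by rewrite xyx subrr subr0.
Qed.

Lemma splits_as_initial A : exchange_ring R -> invertible_mx A ->
  exists g h, splits_as A g h.
Proof.
move=> exR [A' [AA' A'A]].
pose a := ulsubmx A; pose b := ursubmx A; pose c := ulsubmx A'; pose d := dlsubmx A'.
have ab1 : a *m c + b *m d = 1%:M.
  have := AA'; rewrite -{1}[A]submxK -{1}[A']submxK mulmx_block scalar_mx_block.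
  by case/eq_block_mx.
have [e [ee [r er] [s es]]] := exchange_mx11 exR (a *m c).
have {}es : 1%:M - e = b *m d *m s by rewrite es -ab1 addrC addKr.
(* The right factors [e] and [1 - e] are what makes the off-diagonal blocks of [v *m u] vanish at
   the end. *)
pose r0 := c *m r *m e; pose s0 := d *m s *m (1%:M - e).
have ar0 : a *m r0 = e by rewrite /r0 !mulmxA -er ee.
have bs0 : b *m s0 = 1%:M - e.
  by rewrite /s0 !mulmxA -es (idem_compl ee).
have r0e : r0 *m e = r0 by rewrite /r0 -mulmxA ee.
have s0e : s0 *m e = 0 by rewrite /s0 -mulmxA mulmxBl mul1mx ee subrr mulmx0.
(* Column operations turning the first row [(a, b)] of [A] into [(e a, (1 - e) b)]: the first
   subtracts [a r0 b = e b] from [b], the second subtracts [(1 - e) a] from [a]. *)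
pose N := block_mx 1%:M (- (r0 *m b)) 0 1%:M *m block_mx 1%:M 0 (- (s0 *m a)) 1%:M.
have EN : E_mx N by apply: gen_mul; [apply: E_upper | apply: E_lower].
pose v := col_mx r0 s0.
pose u := row_mx (e *m a) ((1%:M - e) *m b).
have rowN : row_mx a b *m N = u.
  rewrite mulmxA mul_row_block !(mulmx1, mulmx0, addr0) mulmxN mulmxA ar0.
  have -> : - (e *m b) + b = (1%:M - e) *m b by rewrite mulmxBl mul1mx addrC.
  rewrite mul_row_block !(mulmx1, mulmx0, addr0, add0r) mulmxN mulmxA -[_ *m b *m s0]mulmxA bs0.
  congr row_mx.
  by rewrite (idem_compl ee) mulmxBl mul1mx opprB addrC subrK.
clearbody N.
have rowA : row_mx 1%:M 0 *m A = row_mx a b.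
  by rewrite -{1}[A]submxK mul_row_block !(mul1mx, mul0mx, addr0).
have uv : u *m v = 1%:M.
  by rewrite mul_row_col -!mulmxA ar0 bs0 ee (idem_compl ee) addrC subrK.
(* Clearing [t] by row operations keeps the first row [u] and makes [v] the first column of the
   inverse. *)
pose t := dsubmx (A *m N *m v).
have ANv : A *m N *m v = col_mx 1%:M t.
  rewrite -[LHS]vsubmxK; congr col_mx.
  have -> : usubmx (A *m N *m v) = row_mx 1%:M 0 *m (A *m N *m v).
    by rewrite -{2}[A *m N *m v]vsubmxK mul_row_col mul1mx mul0mx addr0.
  by rewrite !mulmxA rowA rowN uv.
pose L : 'M[R]_(1 + m) := block_mx 1%:M 0 (- t) 1%:M.
have EL : E_mx L by apply: E_lower.
have Lcol : L *m col_mx 1%:M t = col_mx 1%:M 0.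
  by rewrite mul_block_col !(mulmx1, mul1mx, mul0mx, addr0) addNr.
have rowL : row_mx 1%:M 0 *m L = row_mx 1%:M 0.
  by rewrite mul_row_block !(mulmx0, mulmx1, mul0mx, addr0).
have [N' [_ NN' N'N]] := E_inv EN; have [L' [_ LL' L'L]] := E_inv EL.
exists (r0 *m (e *m a)), (s0 *m ((1%:M - e) *m b)), (L *m A *m N), (N' *m A' *m L').
have CB : N' *m A' *m L' *m (L *m A *m N) = 1%:M.
  rewrite !mulmxA -[_ *m L' *m L]mulmxA L'L mulmx1 -[_ *m A' *m A]mulmxA A'A mulmx1.
  exact: N'N.
split; [by exists L, N | | exact: CB |].
  rewrite !mulmxA -[_ *m N *m N']mulmxA NN' mulmx1 -[_ *m A *m A']mulmxA AA' mulmx1.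
  exact: LL'.
(* As a column times a row, [corner1] is conjugated into [v *m u]. *)
have -> : corner1 = col_mx 1%:M 0 *m row_mx 1%:M 0.
  by rewrite mul_col_row !(mul0mx, mulmx0, mulmx1).
have Cv : N' *m A' *m L' *m col_mx 1%:M 0 = v.
  by rewrite -Lcol -ANv -[RHS]mul1mx -CB !mulmxA.
rewrite !mulmxA Cv -[v *m _ *m L]mulmxA rowL -[v *m _ *m A]mulmxA rowA.
rewrite -[v *m _ *m N]mulmxA rowN mul_col_row; congr block_mx.
- by rewrite mulmxA.
- by rewrite mulmxA mulmxBr mulmx1 r0e subrr mul0mx.
- by rewrite mulmxA s0e mul0mx.
- by rewrite mulmxA.
Qed.

(* The identity [z + b *m d = 1] expresses an embedding of E in Z + H through the maps [z]
   and [b], [d]; the part of E going to H is moved away and the remaining part [f]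
   factors through [z]. *)
Lemma splits_as_absorb A g h (z : 'M[R]_1) (b : 'M[R]_(1, m)) (d : 'M[R]_(m, 1)) :
  exchange_ring R -> splits_as A g h ->
  z + b *m d = 1%:M -> b *m h = 0 -> h *m d = 0 ->
  exists f h', [/\ splits_as A f h', g *m f = f, f *m g = f,
    exists r, f = g *m z *m g *m r & fgp_le h h'].
Proof.
move=> exR sA zbd bh hd; have [gg hh] := splits_as_idem sA.
have gzg : g *m (g *m z *m g) = g *m z *m g by rewrite !mulmxA gg.
have [f [ff gf fg fr [s gfs]]] := exchange_corner exR gg gzg.
pose e := g - f.
have ee : idem_mx e by rewrite /idem_mx mulmxBl !mulmxBr gg gf fg ff subrr subr0.
have eg : e *m g = e by rewrite mulmxBl gg fg.
have ge : g *m e = e by rewrite mulmxBr gg gf.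
have es : e = g *m b *m d *m g *m s.
  rewrite -[g *m b *m d]mulmxA /e gfs; congr (_ *m _).
  by rewrite -[b *m d](addKr z) zbd mulmxDr mulmxN mulmx1 mulmxDl gg mulNmx addrC.
(* Since [g - g z g = g b d g], the complement [e] of [f] in [g] factors through [b] and [d], whose
   vanishing against [h] puts the copy [x *m y] in H. *)
pose y := e *m b; pose x := d *m g *m s *m e.
have yx : y *m x = e.
  transitivity (e *m (g *m b *m d *m g *m s) *m e); first by rewrite !mulmxA eg.
  by rewrite -es !ee.
have ye : e *m y = y by rewrite mulmxA ee.
have xe : x *m e = x by rewrite -mulmxA ee.
have hx : h *m x = 0 by rewrite !mulmxA hd !mul0mx.
have yh : y *m h = 0 by rewrite -mulmxA bh mulmx0.
exists f, (h + x *m y); split=> //.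
- have -> : f = g - y *m x by rewrite yx opprB addrC subrK.
  apply: splits_as_swap => //; first by rewrite -mulmxA yx.
  + by rewrite yx.
  + by rewrite mulmxA ge.
  + by rewrite -xe -mulmxA eg.
- exists h, h; split; first by rewrite mulmxDl hh -mulmxA yh mulmx0 addr0.
  by rewrite mulmxDr hh mulmxA hx mul0mx addr0.
Qed.

Lemma fgp_le_trans k n l (c : 'M[R]_k) (b : 'M[R]_n) (a : 'M[R]_l) :
  fgp_le c b -> fgp_le b a -> fgp_le c a.
Proof.
move=> [i [p [bi [pb pi]]]] [j [q [aj [qa qj]]]].
exists (j *m i), (p *m q); split; first by rewrite mulmxA aj.
by rewrite -!mulmxA qa; split=> //; rewrite [q *m _]mulmxA qj bi.
Qed.

(** The maps [i] and [p] make R a summand of R^m. Reading R^m as P2 = F + H, one absorption embeds E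
    in F; reading it as Q2 = G + H, a second embeds E in G. The first embedding survives, as E only
    shrinks and F only grows. *)
Lemma splits_as_cancellable A (i : 'M[R]_(m, 1)) (p : 'M[R]_(1, m)) :
  p *m i = 1%:M -> exchange_ring R -> invertible_mx A ->
  exists g h, [/\ splits_as A g h, fgp_le g h & fgp_le g (1%:M - g)].
Proof.
move=> pi exR invA; have [g0 [h0 s0]] := splits_as_initial exR invA.
have [_ hh0] := splits_as_idem s0.
have [g [h [s1 _ _ [r gr] h0h]]] : exists f h', [/\ splits_as A f h', g0 *m f = f,
    f *m g0 = f, exists r, f = g0 *m (p *m h0 *m i) *m g0 *m r & fgp_le h0 h'].
  (* Here [p *m i = 1] is split by [h0] into a part through F, taken as [z], and a part through
     H. *)
  apply: (@splits_as_absorb _ _ _ _ (p *m (1%:M - h0)) ((1%:M - h0) *m i)) => //.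
  - rewrite mulmxA -[p *m _ *m (1%:M - h0)]mulmxA (idem_compl hh0) -mulmxDl -mulmxDr.
    by rewrite addrC subrK mulmx1.
  - by rewrite -mulmxA mulmxBl mul1mx hh0 subrr mulmx0.
  - by rewrite mulmxA mulmxBr mulmx1 hh0 subrr mul0mx.
have [gg hh] := splits_as_idem s1.
have gh : fgp_le g h.
  apply: fgp_le_trans h0h.
  exists (h0 *m i *m g0 *m r), (g0 *m p *m h0); split; first by rewrite !mulmxA hh0.
  split; first by rewrite -mulmxA hh0.
  by rewrite !mulmxA -[_ *m h0 *m h0]mulmxA hh0 gr !mulmxA.
have [B [C [_ BC CB CpB]]] := s1.
(* The identity of R now factors through Q2, pulled back to P1 + P2 by [B] and [C]; [a], [c] are the
   components at P1 and [b], [d] those at P2. *)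
pose a := lsubmx (row_mx 0 p *m B); pose b := rsubmx (row_mx 0 p *m B).
pose c := usubmx (C *m col_mx 0 i); pose d := dsubmx (C *m col_mx 0 i).
have abB : row_mx 0 p *m B = row_mx a b by rewrite hsubmxK.
have Ccd : C *m col_mx 0 i = col_mx c d by rewrite vsubmxK.
have acbd : a *m c + b *m d = 1%:M.
  rewrite -mul_row_col -abB -Ccd mulmxA -[_ *m B *m C]mulmxA BC mulmx1.
  by rewrite mul_row_col mul0mx add0r.
(* The row [(0, p)] kills Q1, so [(a, b)] kills its preimage E + F; dually, the column [(c, d)]
   lands in G + H. *)
have [ag bh] : a *m g = 0 /\ b *m h = 0.
  suff /eq_row_mx[]: row_mx (a *m g) (b *m h) = row_mx 0 0 by [].
  have := congr1 (mulmx (row_mx a b)) CpB.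
  rewrite mul_row_block !mulmx0 addr0 add0r => <-.
  rewrite -abB !mulmxA -[_ *m B *m C]mulmxA BC mulmx1 mul_row_block.
  by rewrite !(mulmx0, mul0mx, addr0) row_mx0 mul0mx.
have [gc hd] : g *m c = 0 /\ h *m d = 0.
  suff /eq_col_mx[]: col_mx (g *m c) (h *m d) = col_mx 0 0 by [].
  have := congr1 (mulmx^~ (col_mx c d)) CpB.
  rewrite mul_block_col !mul0mx addr0 add0r => <-.
  rewrite -Ccd !mulmxA -[_ *m B *m C]mulmxA BC mulmx1 -mulmxA mul_block_col.
  by rewrite !(mulmx0, mul0mx, addr0) col_mx0 mulmx0.
have [f [h' [s2 gf fg [t ft] hh']]] := splits_as_absorb exR s1 acbd bh hd.
have [ff _] := splits_as_idem s2.
exists f, h'; split=> //.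
  apply: fgp_le_trans hh'; apply: fgp_le_trans gh.
  by exists f, f.
(* As [f] lies under [g], the relations [a g = 0] and [g c = 0] also hold with [f], so both maps
   pass through the enlarged G. *)
exists (c *m g *m t), (g *m a); split.
  by rewrite mulmxBl mul1mx -{1}fg !mulmxA -[f *m g *m c]mulmxA gc mulmx0 !mul0mx subr0.
split; last by rewrite ft !mulmxA.
by rewrite mulmxBr mulmx1 -{1}gf !mulmxA -[g *m a *m g]mulmxA ag mulmx0 mul0mx subr0.
Qed.

(** Cancelling E in G + E = R = F + E gives an isomorphism of G with F; moving all of both leaves E
    = P1 and F = 0. *)
Lemma splits_as_corner A (i : 'M[R]_(m, 1)) (p : 'M[R]_(1, m)) :
  p *m i = 1%:M -> exchange_ring R -> separative R -> invertible_mx A ->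
  splits_as A 1%:M 0.
Proof.
move=> pi exR sepR invA.
have [g [h [sA gh gg']]] := splits_as_cancellable pi exR invA.
have [gg hh] := splits_as_idem sA; have cg := idem_compl gg.
have id1 : idem_mx (1%:M : 'M[R]_1) by rewrite /idem_mx mulmx1.
have : fgp_iso (1%:M - g) h.
  apply: (separative_cancel sepR gg) => //.
  apply: (@fgp_iso_trans _ _ _ _ _ (1%:M : 'M[R]_1)); do ?exact: idem_sum.
    apply: (fgp_iso_intro (x := row_mx (1%:M - g) g) (y := col_mx (1%:M - g) g)) => //.
    - exact: idem_sum.
    - rewrite mul_col_row cg gg mulmxBl mulmxBr mul1mx mulmx1 gg subrr.
      by rewrite /fgp_sum.
    - by rewrite mul_row_col cg gg subrK.
  apply: (@fgp_iso_trans _ _ _ _ _ (fgp_sum g h)) => //; do ?exact: idem_sum.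
    exact: splits_as_iso sA.
  exact: fgp_sumC.
move=> [x [y [xE [yE [yx xy]]]]].
have -> : 1%:M = g + y *m x by rewrite yx addrC subrK.
rewrite -[0](subrr (x *m y)) {1}xy.
have hx : h *m x = x by rewrite xE !mulmxA hh.
have yh : y *m h = y by rewrite yE -!mulmxA hh.
have gy : g *m y = 0 by rewrite yE !mulmxA mulmxBr mulmx1 gg subrr !mul0mx.
have xg : x *m g = 0 by rewrite xE -!mulmxA mulmxBl mul1mx gg subrr !mulmx0.
by apply: splits_as_swapV => //; rewrite -?mulmxA ?xy ?mulmxA ?xy // yh.
Qed.

End Splitting.

(** * Whitehead's lemma and reduction to a single unit *)

Section Diagonalization.
Variable R : nzRingType.

Lemma E_whitehead n (v v' : 'M[R]_1) : v *m v' = 1%:M -> v' *m v = 1%:M ->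
  E_mx (block_mx v' 0 0 (block_mx v 0 0 (1%:M : 'M[R]_n))).
Proof.
move=> vv' v'v.
have swap (w w' : 'M[R]_1) : w *m w' = 1%:M -> w' *m w = 1%:M ->
    E_mx (block_mx 0 (- row_mx w' 0) (col_mx w 0) (block_mx 0 0 0 (1%:M : 'M[R]_n))).
  move=> ww' w'w.
  have yx : row_mx w' 0 *m col_mx w (0 : 'M[R]_(n, 1)) = 1%:M.
    by rewrite mul_row_col mulmx0 addr0.
  have := @E_swap R _ _ (col_mx w (0 : 'M[R]_(n, 1))) (row_mx w' 0).
  rewrite yx -mulmxA yx mulmx1 subrr mul_col_row !(mulmx0, mul0mx) ww'.
  rewrite (scalar_mx_block 1 n) opp_block_mx add_block_mx !oppr0 !addr0 subrr.
  exact.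
have v1 : (1%:M : 'M[R]_1) *m 1%:M = 1%:M by rewrite mulmx1.
(* The swap for [v], [v'] is monomial on the first two coordinates; the swap for [-1], [-1] brings
   it back to diagonal form. *)
have := gen_mul (swap _ _ vv' v'v) (swap (- 1%:M) (- 1%:M) _ _).
rewrite mulNmx mulmxN opprK mulmx1 => /(_ erefl erefl).
rewrite mulmx_block !mul0mx !mulmx0 !(mulNmx, mulmxN) mul_row_col mul_block_col.
rewrite mul_row_block mul_col_row mulmx_block opp_block_mx add_block_mx.
rewrite !(mul0mx, mulmx0, mulmx1, mulmxN, addr0, add0r, opprK, oppr0).
by rewrite row_mx0 col_mx0 oppr0.
Qed.

(** A matrix commuting with the projection [corner1] preserves its image and kernel, hence is block
    diagonal. *)
Lemma invertible_corner_commute m (B C : 'M[R]_(1 + m)) :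
  B *m C = 1%:M -> C *m B = 1%:M -> C *m corner1 R m *m B = corner1 R m ->
  exists u u' d d', [/\ B = block_mx u 0 0 d, u *m u' = 1%:M, u' *m u = 1%:M,
    d *m d' = 1%:M & d' *m d = 1%:M].
Proof.
move=> BC CB CpB.
have pB : corner1 R m *m B = B *m corner1 R m.
  by rewrite -{2}CpB !mulmxA BC mul1mx.
have Bd : B = block_mx (ulsubmx B) 0 0 (drsubmx B).
  move: pB; rewrite -{1 2}[B]submxK /corner1 !mulmx_block.
  rewrite !(mul1mx, mulmx1, mul0mx, mulmx0, addr0, add0r).
  by case/eq_block_mx=> _ ur dl _; rewrite -[LHS]submxK ur -dl.
move: BC CB; rewrite Bd -[C]submxK !mulmx_block (scalar_mx_block 1 m).
rewrite !(mul0mx, mulmx0, addr0, add0r) => /eq_block_mx[uu _ _ dd] /eq_block_mx[u'u _ _ d'd].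
by exists (ulsubmx B), (ulsubmx C), (drsubmx B), (drsubmx C).
Qed.

Lemma block_diag_mx n (u : 'M[R]_1) :
  block_mx u 0 0 (1%:M : 'M[R]_n) = diag_mx (row_mx u (const_mx 1)).
Proof.
rewrite diag_mx_row diag_const_mx; congr block_mx.
by apply/matrixP=> i j; rewrite !mxE !ord1 eqxx.
Qed.

Lemma E_diag1_decomp : exchange_ring R -> separative R ->
  forall m (A : 'M[R]_(1 + m)), invertible_mx A ->
  exists (M : 'M[R]_(1 + m)) (u u' : 'M[R]_1), [/\ E_mx M, u *m u' = 1%:M, u' *m u = 1%:M
    & A = M *m block_mx u 0 0 1%:M].
Proof.
move=> exR sepR; elim=> [|m IHm] A invA.
  have [A' [AA' A'A]] := invA.
  have blk (X : 'M[R]_(1 + 0)) : X = block_mx (ulsubmx X) 0 0 1%:M.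
    by rewrite -{1}[X]submxK [ursubmx X]thinmx0 [dlsubmx X]flatmx0 [drsubmx X]flatmx0
      [1%:M]flatmx0.
  have ul (X Y : 'M[R]_(1 + 0)) : X *m Y = 1%:M -> ulsubmx X *m ulsubmx Y = 1%:M.
    move=> XY; have := scalar_mx_block 1 0 (1 : R).
    rewrite -XY -{1}[X]submxK -{1}[Y]submxK mulmx_block => /eq_block_mx[<- _ _ _].
    by rewrite [ursubmx X]thinmx0 mul0mx addr0.
  exists 1%:M, (ulsubmx A), (ulsubmx A'); rewrite mul1mx -blk; split=> //.
  - exact: gen_one.
  - exact: ul.
  - exact: ul.
(* The complementary block has size [1 + m], so R is a summand of it by the first coordinate. *)
have pi : (delta_mx 0 0 : 'M[R]_(1, 1 + m)) *m (delta_mx 0 0 : 'M[R]_(1 + m, 1)) = 1%:M.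
  by rewrite mul_delta_mx; apply/matrixP=> i j; rewrite !mxE !ord1 eqxx.
have [B [C [[L [N [EL EN BE]]] BC CB CpB]]] := splits_as_corner pi exR sepR invA.
have [u [u' [d [d' [Bd uu' u'u dd' d'd]]]]] := invertible_corner_commute BC CB CpB.
have [M [v [v' [EM vv' v'v dE]]]] := IHm d (ex_intro _ d' (conj dd' d'd)).
have [L' [EL' LL' L'L]] := E_inv EL; have [N' [EN' NN' N'N]] := E_inv EN.
pose D : 'M[R]_(1 + (1 + m)) := block_mx (v *m u) 0 0 1%:M.
pose D' : 'M[R]_(1 + (1 + m)) := block_mx (u' *m v') 0 0 1%:M.
have vu1 : v *m u *m (u' *m v') = 1%:M.
  by rewrite mulmxA -[v *m u *m u']mulmxA uu' mulmx1.
have vu2 : u' *m v' *m (v *m u) = 1%:M.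
  by rewrite mulmxA -[u' *m v' *m v]mulmxA v'v mulmx1.
have DD' : D *m D' = 1%:M.
  by rewrite mulmx_block !(mul0mx, mulmx0, addr0, add0r) vu1 mulmx1 -scalar_mx_block.
have D'D : D' *m D = 1%:M.
  by rewrite mulmx_block !(mul0mx, mulmx0, addr0, add0r) vu2 mulmx1 -scalar_mx_block.
(* Whitehead's matrix merges the two units: [diag(u, v, 1) = W D] with [D = diag(v u, 1, 1)]. *)
pose W : 'M[R]_(1 + (1 + m)) := block_mx v' 0 0 (block_mx v 0 0 1%:M).
have BWD : B = block_mx 1%:M 0 0 M *m W *m D.
  rewrite Bd !mulmx_block !(mul0mx, mulmx0, addr0, add0r) !mul1mx mulmx1 -dE.
  by rewrite mulmxA v'v mul1mx.
(* The elementary factor [N'] to the right of [D] is carried to its left as the conjugate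
   [D N' D']. *)
exists (L' *m (block_mx 1%:M 0 0 M *m W) *m (D *m N' *m D')), (v *m u), (u' *m v'); split=> //.
  apply: gen_mul; first by apply: gen_mul => //; apply: gen_mul;
    [exact: E_block1 | exact: E_whitehead].
  by move: DD' D'D; rewrite /D /D' !block_diag_mx => DD' D'D; apply: E_conj_diag.
rewrite -/D -!mulmxA D'D mulmx1 [W *m _]mulmxA [block_mx _ _ _ _ *m _]mulmxA.
rewrite [block_mx _ _ _ _ *m (W *m D)]mulmxA -BWD BE -!mulmxA NN' mulmx1 mulmxA L'L.
by rewrite mul1mx.
Qed.

End Diagonalization.

(** * Passage to generation by elementary and diagonal matrices and to classes in K_1 *)

Lemma gen_group_sub (R : nzRingType) n (S T : 'M[R]_n -> Prop) A :
  (forall B, S B -> T B) -> gen_group S A -> gen_group T A.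
Proof.
move=> ST; elim=> [|B /ST|B C _ TB _ TC|B C _ TB BC CB].
- exact: gen_one.
- exact: gen_in.
- exact: gen_mul.
- exact: (gen_inv TB).
Qed.

Lemma mx11_unit (R : nzRingType) (u u' : 'M[R]_1) :
  u *m u' = 1%:M -> u' *m u = 1%:M -> is_unit (u 0 0).
Proof.
rewrite [u]mx11_scalar [u']mx11_scalar -!scalar_mxM => uu' u'u.
exists (u' 0 0); split.
  by have := congr1 (fun X : 'M_1 => X 0 0) uu'; rewrite !mxE !eqxx.
by have := congr1 (fun X : 'M_1 => X 0 0) u'u; rewrite !mxE !eqxx.
Qed.

Lemma is_unit1 (R : nzRingType) : is_unit (1 : R).
Proof. by exists 1; rewrite mulr1. Qed.

Lemma stab_mx_id (R : nzRingType) n (A : 'M[R]_n) : stab_mx n A = A.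
Proof.
apply/matrixP=> i j; rewrite mxE !insubT //= => ? ?.
by congr (A _ _); apply: val_inj.
Qed.

Lemma stab_mx11 (R : nzRingType) n (u : 'M[R]_1) :
  stab_mx (1 + n) u = block_mx u 0 0 1%:M.
Proof.
apply/matrixP=> i j; rewrite mxE.
case: (split_ordP i) => i' ->; case: (split_ordP j) => j' ->;
  rewrite ?(block_mxEul, block_mxEur, block_mxEdl, block_mxEdr) ?mxE ?ord1 /=;
  rewrite ?[insub (1 + _)%N]insubF ?[insub 0%N]insubT //.
by congr (u _ _); apply: val_inj.
Qed.

Theorem theorem2p8 (R : nzRingType) :
  exchange_ring R -> separative R -> GE_ring R /\ GL1_K1_surjective R.
Proof.
move=> exR sepR; split.
  case=> // n _ A invA.
  have [M [u [u' [EM uu' u'u ->]]]] := E_diag1_decomp exR sepR (invA : @invertible_mx R (1 + n) A).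
  apply: gen_mul; first by apply: gen_group_sub EM => B; left.
  apply: gen_in; right; exists (row_mx u (const_mx 1)); split; last exact: block_diag_mx.
  suff unit_u (i : 'I_(1 + n)) : is_unit (row_mx u (const_mx 1) 0 i) by [].
  case: (split_ordP i) => j ->.
    by rewrite row_mxEl ord1; apply: mx11_unit u'u.
  by rewrite row_mxEr mxE; apply: is_unit1.
(* The empty matrix stabilises in size 1 to the identity, so its class is that of the unit 1. *)
case=> [|n] A invA.
  exists 1; split; first exact: is_unit1.
  exists 1%N; do 2?split=> //; exists 1%:M; split; first exact: gen_one.
  rewrite mul1mx stab_mx_id; apply/matrixP=> i j.
  by rewrite !mxE !ord1 /= insubF.
have [M [u [u' [EM uu' u'u AE]]]] := E_diag1_decomp exR sepR (invA : @invertible_mx R (1 + n) A).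
exists (u 0 0); split; first exact: mx11_unit u'u.
exists n.+1; do 2?split=> //; exists M; split=> //.
by rewrite stab_mx_id -mx11_scalar stab_mx11.
Qed.
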